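(* Let $S$ be a regular LA-semigroup. Then $S$ is fully prime if and only if the set of ideals of $S$ is totally ordered under inclusion.
   Context: An LA-semigroup (left almost semigroup) is a set $S$ with a binary operation satisfying the left invertive law $(ab)c=(cb)a$ for all $a,b,c\in S$ (the operation is not assumed associative). $S$ is regular if for each $a\in S$ there exists $x\in S$ such that $a=(ax)a$. For subsets $A,B\subseteq S$, $AB=\{ab: a\in A, b\in B\}$. A subset $I\subseteq S$ is a right (left) ideal if $IS\subseteq I$ ($SI\subseteq I$), and an ideal if it is both. An ideal $P$ of $S$ is prime if for all ideals $A,B$ of $S$, $AB\subseteq P$ implies $A\subseteq P$ or $B\subseteq P$. $S$ is fully prime if every ideal of $S$ is prime. The set of ideals of $S$ is totally ordered under inclusion if for all ideals $A,B$ of $S$, either $A\subseteq B$ or $B\subseteq A$. *)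

(* Defs.v *)
From HB Require Import structures.
From mathcomp Require Import all_boot all_classical.

Set Implicit Arguments.
Unset Strict Implicit.
Unset Printing Implicit Defensive.

Local Open Scope classical_set_scope.
Local Open Scope group_scope.

(* MathComp's [magmaType] is a bare type with a binary operation; an LA-semigroup
   adds only the left invertive law (no associativity, no identity). *)
HB.mixin Record Magma_isLASemigroup S of Magma S := {
  left_invertive : forall a b c : S, (a * b) * c = (c * b) * a
}.

#[short(type="laSemigroupType")]
HB.structure Definition LASemigroup :=
  {S of Magma_isLASemigroup S & Magma S}.

Section Ideals.
Variable S : laSemigroupType.
Implicit Types A B I P : set S.

Definition regular := forall a : S, exists x : S, a = (a * x) * a.

Definition set_prod A B : set S := [set a * b | a in A & b in B].

Definition right_ideal I := set_prod I setT `<=` I.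

Definition left_ideal I := set_prod setT I `<=` I.

(* The empty set counts as an ideal. *)
Definition ideal I := left_ideal I /\ right_ideal I.

(* The whole of S is allowed as a prime ideal. *)
Definition prime_ideal P :=
  ideal P /\
  forall A B, ideal A -> ideal B -> set_prod A B `<=` P -> A `<=` P \/ B `<=` P.

Definition fully_prime := forall P, ideal P -> prime_ideal P.

End Ideals.

Arguments regular S : clear implicits.
Arguments fully_prime S : clear implicits.

(* Main.v *)
Require Import Defs.
From mathcomp Require Import all_boot all_classical.

(** In a regular LA-semigroup the product of two ideals is their intersection.
    It lies in both factors because they absorb multiplication
    ([set_prod_subI]).  Conversely, an element [x] of [A `&` B] is the product
    of [x * y], which lies in [A], and [x], which lies in [B], for any [y] with
    [x = (x * y) * x] ([regular_subI_set_prod]).  Primeness of [P] thus says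
    that [A `&` B `<=` P] forces [A `<=` P] or [B `<=` P].

    If all ideals are prime, this applies to the ideal [P := A `&` B] itself,
    and an inclusion of [A] or [B] in the intersection is comparability.
    Conversely, in a chain the intersection of two ideals is one of the two, so
    an ideal containing their product contains that one. *)

Local Open Scope classical_set_scope.

Lemma idealI (S : laSemigroupType) (A B : set S) :
  ideal A -> ideal B -> ideal (A `&` B).
Proof.
move=> [lA rA] [lB rB]; split=> _ [x Hx [y Hy <-]].
- by case: Hy => Ay By; split; [apply: lA | apply: lB]; exists x => //; exists y.
- by case: Hx => Ax Bx; split; [apply: rA | apply: rB]; exists x => //; exists y.
Qed.

Lemma set_prod_subI (S : laSemigroupType) (A B : set S) :
  right_ideal A -> left_ideal B -> set_prod A B `<=` A `&` B.
Proof.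
move=> rA lB _ [a Aa [b Bb <-]].
by split; [apply: rA | apply: lB]; exists a => //; exists b.
Qed.

Lemma regular_subI_set_prod (S : laSemigroupType) (A B : set S) :
  regular S -> right_ideal A -> A `&` B `<=` set_prod A B.
Proof.
move=> regS rA x [Ax Bx]; have [y xE] := regS x.
exists (x * y)%g; last by exists x.
by apply: rA; exists x => //; exists y.
Qed.

Theorem theorem8 (S : laSemigroupType) (regS : regular S) :
  fully_prime S <-> total_on [set I : set S | ideal I] subset.
Proof.
split=> [primeS A B iA iB|totS P iP].
  have [_ primeAB] := primeS _ (idealI _ _ _ iA iB).
  have [|AB|AB] := primeAB A B iA iB.
  - exact: set_prod_subI iA.2 iB.1.
  - by left=> x /AB[].
  - by right=> x /AB[].
split=> // A B iA iB ABP.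
have IP : A `&` B `<=` P.
  exact: subset_trans (regular_subI_set_prod _ _ _ regS iA.2) ABP.
have [AB|BA] := totS A B iA iB; [left|right] => x xI; apply: IP.
- by split=> //; apply: AB.
- by split=> //; apply: BA.
Qed.
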